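(* Let $m,n,d\ge1$ with $\gcd(m,n)=1$, let $C$ be a plane curve singularity over $\mathbb{C}$ with parametrization $(x(t),y(t))=(t^{nd},t^{md}+\lambda t^{md+1}+\ldots)$, $\lambda\neq0$, and let $\Delta\subset\mathbb{Z}_{\ge0}$ be a cofinite $(nd,md)$-invariant subset. Suppose that $J_\Delta\neq\emptyset$. Then $\Delta$ is admissible.
   Context: $\Delta\subset\mathbb{Z}_{\ge0}$ is cofinite if $\mathbb{Z}_{\ge0}\setminus\Delta$ is finite, and $(nd,md)$-invariant if $\Delta+nd\subset\Delta$ and $\Delta+md\subset\Delta$. An $(nd)$-generator is an $a\in\Delta$ with $a-nd\notin\Delta$; there is exactly one in each class mod $nd$, and those congruent to $j$ mod $d$ are denoted $a_{j,0},\dots,a_{j,n-1}$. $\Delta$ is admissible if for every $j\in\{0,\dots,d-1\}$ there exists $i$ with $a_{j,i}+md+1\in\Delta$. Let $\mathcal{O}_C=\mathbb{C}[[x(t),y(t)]]\subset\mathbb{C}((t))$; for $M\subset\mathbb{C}((t))$ let $\Delta_M$ be the set of orders in $t$ of the nonzero elements of $M$, and $J_\Delta=\{M\subset\mathbb{C}((t)):\ \mathcal{O}_CM\subset M,\ \Delta_M=\Delta\}$ (closed $\mathbb{C}$-subspaces $M$). *)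

(* Defs.v *)
From mathcomp Require Import all_boot all_order all_algebra.
From mathcomp Require Import all_classical all_reals.
From mathcomp Require Import complex.

Set Implicit Arguments.
Unset Strict Implicit.
Unset Printing Implicit Defensive.

Import Order.TTheory GRing.Theory Num.Theory.

Local Open Scope classical_set_scope.
Local Open Scope ring_scope.

Section Semimodules.
Implicit Types (p q : nat) (Delta : set int).

Definition nonneg_int : set int := [set k | 0 <= k].

Definition cofinite Delta := finite_set (nonneg_int `\` Delta).

Definition pq_invariant p q Delta :=
  forall a, Delta a -> Delta (a + p%:Z) /\ Delta (a + q%:Z).

Definition generators p Delta : set int :=
  [set a | Delta a /\ ~ Delta (a - p%:Z)].

(* The set {a_(j,0), ..., a_(j,n-1)}. *)
Definition generators_mod n d Delta (j : nat) : set int :=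
  [set a | generators (n * d) Delta a /\ (a = j%:Z %[mod d%:Z])%Z].

Definition admissible m n d Delta :=
  forall j : 'I_d, exists2 a, generators_mod n d Delta j a
                            & Delta (a + (m * d)%:Z + 1).

End Semimodules.

Section LaurentSeries.
Variable K : fieldType.

(* A series in t is given by its coefficients: f stands for
   \sum_k f k * t^k, and lies in K((t)) when it satisfies [laurent]. *)
Definition coeffs := int -> K.
Implicit Types (f g x y : coeffs) (M : set coeffs).

Definition laurent : set coeffs :=
  [set f | exists N : int, forall k, k < N -> f k = 0].

(* For Laurent series the sum has finite support.  (A finitely supported sum
   \sum_(_ \in _) is 0 by convention when the support is infinite.) *)
Definition lmul f g : coeffs :=
  fun k => \sum_(i \in [set: int]) (f i * g (k - i)).

Definition lmonomial (e : int) : coeffs := fun k => (k == e)%:R.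

Definition lpow f (e : nat) : coeffs := iter e (lmul f) (lmonomial 0).

Definition has_order f (k : int) := f k != 0 /\ forall i, i < k -> f i = 0.

(* K[[x(t), y(t)]]: the series \sum_(a, b) c(a, b) x^a y^b.  When x and y have
   positive order, only finitely many pairs (a, b) contribute to the
   coefficient of each t^k. *)
Definition local_ring x y : set coeffs :=
  [set h | exists c : nat * nat -> K, forall k : int,
     h k = \sum_(ab \in [set: nat * nat])
             (c ab * lmul (lpow x ab.1) (lpow y ab.2) k)].

Definition linear_subspace M :=
  M (fun=> 0) /\
  forall (a : K) f g, M f -> M g -> M (fun k => a * f k + g k).

(* Closed in K((t)) for the t-adic topology. *)
Definition tadic_closed M :=
  forall f, laurent f ->
    (forall N : int, exists2 g, M g & forall k, k < N -> g k = f k) -> M f.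

Definition orders M : set int := [set k | exists2 f, M f & has_order f k].

Definition J_ (O : set coeffs) (Delta : set int) : set (set coeffs) :=
  [set M | [/\ M `<=` laurent, linear_subspace M, tadic_closed M,
               (forall h f, O h -> M f -> M (lmul h f))
             & orders M = Delta]].

End LaurentSeries.

(* Main.v *)
Require Import Defs.
From mathcomp Require Import all_boot all_order all_algebra.
From mathcomp Require Import all_classical all_reals.
From mathcomp Require Import complex.
From mathcomp Require Import finmap zify ring.

Set Implicit Arguments.
Unset Strict Implicit.
Unset Printing Implicit Defensive.

Import Order.TTheory GRing.Theory Num.Theory.

Local Open Scope classical_set_scope.
Local Open Scope ring_scope.

(** Write p = m d and e = n d, let M be a module in J_Delta, and fix a class j
    mod d.  For each e-generator a congruent to j mod d choose f_a in M of the
    form t^a + u_a t^(a+1) + ...  As p is divisible by d, a + p lies in Delta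
    and in the same class mod d, so a + p = b + k e for some generator b of that
    class and some k >= 0.  In the difference

      y f_a - x^k f_b = (lambda + u_a - u_b) t^(a+p+1) + ...

    the leading terms cancel, and the difference lies in M.  If a + p + 1 were
    outside Delta, its coefficient there would have to vanish, which says
    u_b = u_a + lambda ([second_coeff_step]).

    Suppose this happens for every generator in the class j.  Then each step
    a |-> b increases u by lambda.  After n steps the residue mod e has moved by
    n p = m e, so the walk is back at the starting generator
    ([generator_uniq]), while u has grown by n lambda.  Hence n lambda = 0, which
    is impossible in characteristic 0.

    The walk is indexed by the integers j + i p, each sent to the generator in
    its class mod e, so that its i-th point needs no recursion. *)

(** * Products of series *)

Lemma lmul_lmonomiall (K : fieldType) (e : int) (f : coeffs K) :
  lmul (lmonomial K e) f = fun k => f (k - e).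
Proof.
apply: funext => k; rewrite /lmul (fsbigTE [fset e]%fset).
  by rewrite big_seq_fset1 /lmonomial eqxx mul1r.
by move=> i; rewrite inE /lmonomial => /negPf ->; rewrite mul0r.
Qed.

Lemma lmul_lmonomialr (K : fieldType) (e : int) (f : coeffs K) :
  lmul f (lmonomial K e) = fun k => f (k - e).
Proof.
apply: funext => k; rewrite /lmul (fsbigTE [fset (k - e)]%fset).
  by rewrite big_seq_fset1 /lmonomial subKr eqxx mulr1.
move=> i; rewrite inE /lmonomial => ne_i.
case: eqP => [eq_e|]; last by rewrite mulr0.
by case/eqP: ne_i; rewrite -eq_e subKr.
Qed.

Lemma lpow_lmonomial (K : fieldType) (e k : nat) :
  lpow (lmonomial K e) k = lmonomial K (k * e)%N.
Proof.
elim: k => [|k IHk]; first by rewrite mul0n.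
rewrite /lpow iterS -/(lpow _ _) IHk lmul_lmonomiall; apply: funext => i.
by rewrite /lmonomial subr_eq mulSn addrC -PoszD addnC.
Qed.

Lemma lmul_eq0 (K : fieldType) (f g : coeffs K) (p a k : int) :
  (forall i, i < p -> f i = 0) -> (forall i, i < a -> g i = 0) ->
  k < p + a -> lmul f g k = 0.
Proof.
move=> f_lt g_lt k_lt; apply: fsbig1 => i _.
have [/f_lt ->|le_pi] := ltP i p; first by rewrite mul0r.
by rewrite g_lt ?mulr0//; lia.
Qed.

(** When f and g vanish below p and a, a product f_i g_(p+a-i) can be nonzero
    only for p <= i <= p, and in the next lemma only for p <= i <= p + 1. *)
Lemma lmul_lead (K : fieldType) (f g : coeffs K) (p a : int) :
  (forall i, i < p -> f i = 0) -> (forall i, i < a -> g i = 0) ->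
  lmul f g (p + a) = f p * g a.
Proof.
move=> f_lt g_lt; rewrite /lmul (fsbigTE [fset p]%fset).
  by rewrite big_seq_fset1 addrC addKr.
move=> i; rewrite inE => ne_ip.
have [/f_lt ->|le_pi] := ltP i p; first by rewrite mul0r.
by rewrite g_lt ?mulr0//; lia.
Qed.

Lemma lmul_second (K : fieldType) (f g : coeffs K) (p a : int) :
  (forall i, i < p -> f i = 0) -> (forall i, i < a -> g i = 0) ->
  lmul f g (p + a + 1) = f p * g (a + 1) + f (p + 1) * g a.
Proof.
move=> f_lt g_lt; rewrite /lmul (fsbigE [:: p; p + 1]) //=; last first.
- move=> i _; rewrite !inE => /norP[ne_ip ne_ip1].
  have [/f_lt ->|le_pi] := ltP i p; first by rewrite mul0r.
  by rewrite g_lt ?mulr0//; lia.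
- by rewrite inE andbT; lia.
rewrite !big_cons big_nil !ifT ?mem_setT // addr0; congr (_ * g _ + _ * g _); lia.
Qed.

(** * Elements of the local ring *)

Lemma local_ring_monomial (K : fieldType) (x y : coeffs K) (a b : nat) :
  local_ring x y (lmul (lpow x a) (lpow y b)).
Proof.
exists (fun ab => (ab == (a, b))%:R) => k.
rewrite (fsbigTE [fset (a, b)]%fset) ?big_seq_fset1 ?eqxx ?mul1r//.
by move=> ab; rewrite inE => /negPf ->; rewrite mul0r.
Qed.

(** Pure powers of x and the series y itself are the monomials with a zero
    exponent: multiplication by t^0, on either side, changes nothing. *)
Lemma local_ring_powl (K : fieldType) (x y : coeffs K) (a : nat) :
  local_ring x y (lpow x a).
Proof.
suff -> : lpow x a = lmul (lpow x a) (lpow y 0) by exact: local_ring_monomial.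
by rewrite [lpow y 0]/lpow lmul_lmonomialr; apply: funext => k; rewrite subr0.
Qed.

Lemma local_ring_y (K : fieldType) (x y : coeffs K) : local_ring x y y.
Proof.
suff {2}-> : y = lmul (lpow x 0) (lpow y 1) by exact: local_ring_monomial.
rewrite /lpow /= lmul_lmonomiall lmul_lmonomialr.
by apply: funext => k; rewrite !subr0.
Qed.

(** * Generators *)

Lemma invariant_addMn (p q : nat) (Delta : set int) (a : int) (k : nat) :
  pq_invariant p q Delta -> Delta a -> Delta (a + (k * p)%N%:Z).
Proof.
move=> inv Da; elim: k => [|k /inv[IHk _]]; first by rewrite mul0n addr0.
by rewrite mulSn addnC PoszD addrA.
Qed.

(** If a were below b in its class, adding p to a repeatedly would reach b - p,
    which a generator excludes. *)
Lemma generator_le (p q : nat) (Delta : set int) (a b : int) :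
  pq_invariant p q Delta -> Delta a -> generators p Delta b ->
  (a = b %[mod p%:Z])%Z -> exists k : nat, a = b + (k * p)%N%:Z.
Proof.
move=> inv Da [_ nDb] /eqP; rewrite eqz_mod_dvd => /dvdzP[z ab].
(* The multiplier z is either k >= 0 or - (k + 1); the latter puts a at
   b - p - k p. *)
case: z ab => k ab; first by exists k; rewrite PoszM -ab addrC subrK.
case: nDb; suff -> : b - p%:Z = a + (k * p)%N%:Z by exact: invariant_addMn inv Da.
move: ab; rewrite NegzE -addn1 PoszD PoszM => ab.
by rewrite -[a](subrK b) ab; ring.
Qed.

Lemma generator_uniq (p q : nat) (Delta : set int) (a b : int) :
  pq_invariant p q Delta -> generators p Delta a -> generators p Delta b ->
  (a = b %[mod p%:Z])%Z -> a = b.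
Proof.
move=> inv ga gb ab.
have [k ak] := generator_le inv ga.1 gb ab.
have [l bl] := generator_le inv gb.1 ga (esym ab).
by apply/eqP; rewrite eq_le; apply/andP; split; lia.
Qed.

(** The generator is the least element of Delta in the progression of step p
    starting at c mod p; were the progression disjoint from Delta, it would be
    an infinite subset of the finite complement. *)
Lemma generator_exists (p : nat) (Delta : set int) (c : int) : (0 < p)%N ->
  Delta `<=` nonneg_int -> cofinite Delta ->
  exists2 a, generators p Delta a & (a = c %[mod p%:Z])%Z.
Proof.
move=> p_gt0 Delta_ge0 Delta_cof.
set c0 := (c %% p%:Z)%Z; pose s (i : nat) := c0 + (i * p)%N%:Z.
have c0_ge0 : 0 <= c0 by apply: modz_ge0; lia.
have c0_lt : c0 < p%:Z by apply: ltz_pmod.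
have s_inj : injective s.
  by move=> i k /addrI[] /eqP; rewrite eqn_pmul2r // => /eqP.
have ex_i : exists i, `[< Delta (s i) >].
  apply: contrapT => /forallNP nD; apply: infinite_nat.
  have -> : [set: nat] = s @^-1` (nonneg_int `\` Delta).
    apply/seteqP; split=> // i _; split; last by move/asboolP; exact: nD.
    by rewrite /nonneg_int /= addr_ge0.
  by apply: finite_preimage => // i k _ _; exact: s_inj.
case: (ex_minnP ex_i) => i /asboolP Di i_min; exists (s i).
  split=> // Di'; case: i Di i_min Di' => [|i] Di i_min.
    by move/Delta_ge0; rewrite /nonneg_int /s /= mul0n; lia.
  have -> : s i.+1 - p%:Z = s i by rewrite /s mulSn PoszD; ring.
  by move/asboolP/i_min; rewrite ltnn.
by rewrite /s PoszM addrC modzMDl modz_mod.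
Qed.

(** * Comparing second coefficients *)

(** The series y f - t^(k e) h belongs to M and all its coefficients up to
    t^(p+a) vanish: the leading terms cancel because p + a = b + k e.  Its next
    coefficient, f_(a+1) + y_(p+1) - h_(b+1), would make p + a + 1 an order of M
    if it were nonzero. *)
Lemma second_coeff_step (K : fieldType) (O M : set (coeffs K))
    (y f h : coeffs K) (e k : nat) (p a b : int) :
  linear_subspace M -> (forall g f, O g -> M f -> M (lmul g f)) ->
  O y -> O (lmonomial K (k * e)%N) ->
  (forall i, i < p -> y i = 0) -> y p = 1 ->
  M f -> f a = 1 -> (forall i, i < a -> f i = 0) ->
  M h -> h b = 1 -> (forall i, i < b -> h i = 0) ->
  p + a = b + (k * e)%N%:Z -> ~ orders M (p + a + 1) ->
  h (b + 1) = f (a + 1) + y (p + 1).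
Proof.
move=> [_ linM] mulM Oy Ox y_lt yp Mf fa f_lt Mh hb h_lt pab nord.
pose g i := -1 * lmul (lmonomial K (k * e)%N) h i + lmul y f i.
have Mg : M g by apply: linM; exact: mulM.
have gE i : g i = lmul y f i - h (i - (k * e)%N%:Z).
  by rewrite /g lmul_lmonomiall mulN1r addrC.
have g_le i : i < p + a + 1 -> g i = 0.
  rewrite ltzD1 le_eqVlt gE => /predU1P[->|i_lt].
    by rewrite lmul_lead // pab addrK yp fa hb mulr1 subrr.
  by rewrite (lmul_eq0 y_lt f_lt) // h_lt ?subrr //; lia.
have /eqP : g (p + a + 1) = 0.
  by apply/eqP/contraT => ne0; case: nord; exists g.
rewrite gE lmul_second // yp fa mul1r mulr1 subr_eq0 => /eqP ->.
by congr h; rewrite pab; ring.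
Qed.

Theorem lemma3p16 (R : realType) (m n d : nat)
  (m_gt0 : (0 < m)%N) (n_gt0 : (0 < n)%N) (d_gt0 : (0 < d)%N)
  (coprime_mn : coprime m n)
  (x y : coeffs (complex R)) (lambda : complex R)
  (x_eq : x = lmonomial (complex R) (n * d)%N%:Z)
  (y_lt : forall k : int, k < (m * d)%N%:Z -> y k = 0)
  (y_md : y (m * d)%N%:Z = 1)
  (y_md1 : y ((m * d)%N%:Z + 1) = lambda)
  (lambda_neq0 : lambda != 0)
  (Delta : set int)
  (Delta_ge0 : Delta `<=` nonneg_int)
  (Delta_cofinite : cofinite Delta)
  (Delta_invariant : pq_invariant (n * d) (m * d) Delta)
  (J_neq0 : J_ (local_ring x y) Delta !=set0) :
  admissible m n d Delta.
Proof.
case: J_neq0 => M [_ linM _ mulM ordM] j.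
apply: contrapT => nadm.
have nd_gt0 : (0 < n * d)%N by rewrite muln_gt0 n_gt0.
have /choice[gen genP] c :
    exists a, generators (n * d) Delta a /\ (a = c %[mod (n * d)%N%:Z])%Z.
  have [a ga ac] := @generator_exists _ _ c nd_gt0 Delta_ge0 Delta_cofinite.
  by exists a.
(* The choice of series is indexed by the order a itself, not by the step of
   the walk, so that returning to a generator returns to the same series. *)
have /choice[F FP] a : exists f : coeffs (complex R), Delta a ->
    [/\ M f, f a = 1 & forall i, i < a -> f i = 0].
  have [|nDa] := pselect (Delta a); last by exists (fun=> 0) => /nDa.
  rewrite -ordM => -[f Mf [fa_neq0 f_lt]].
  exists (fun i => (f a)^-1 * f i + 0) => _; split.
  - by apply: (linM.2 _ f (fun=> 0)) => //; exact: linM.1.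
  - by rewrite addr0 mulVf.
  - by move=> i /f_lt ->; rewrite mulr0 addr0.
(* The point reached after i steps is the generator congruent to j + i m d. *)
pose c (i : nat) : int := j%:Z + (i * (m * d))%N%:Z.
pose u i := F (gen (c i)) (gen (c i) + 1).
have u_step i : u i.+1 = u i + lambda.
  have [[ga gac] [gb gbc]] := (genP (c i), genP (c i.+1)).
  have [[Mf fa f_lt] [Mh hb h_lt]] := (FP _ ga.1, FP _ gb.1).
  have [] := @generator_le _ _ _ (gen (c i) + (m * d)%N%:Z) _ Delta_invariant _ gb.
  - by case: (Delta_invariant _ ga.1).
  - rewrite gbc -modzDml gac modzDml /c mulSn; congr (_ %% _)%Z.
    by rewrite PoszD; ring.
  move=> k; rewrite addrC => ab; rewrite -y_md1.
  apply: (second_coeff_step linM mulM _ _ y_lt y_md Mf fa f_lt Mh hb h_lt ab).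
  - exact: local_ring_y.
  - by rewrite -lpow_lmonomial -x_eq; exact: local_ring_powl.
  (* An order at this place is exactly a witness of admissibility for j. *)
  - rewrite ordM => Dab; apply: nadm; exists (gen (c i)).
      split=> //; apply/eqP; rewrite eqz_mod_dvd.
      have /eqP := gac; rewrite eqz_mod_dvd => gac'.
      rewrite -[gen _](subrK (c i)) -addrA rpredD //.
        by apply: dvdz_trans gac'; rewrite PoszM dvdz_mull.
      by rewrite /c addrC addKr mulnA PoszM dvdz_mull.
    by rewrite [gen _ + _]addrC.
have uE i : u i = u 0 + lambda *+ i.
  by elim: i => [|i IHi]; rewrite ?mulr0n ?addr0 // u_step IHi mulrSr addrA.
(* After n steps the index has moved by n m d, a multiple of n d. *)
have gen_n : gen (c n) = gen (c 0).
  have [[g0 g0c] [gn gnc]] := (genP (c 0%N), genP (c n)).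
  apply: generator_uniq Delta_invariant gn g0 _.
  rewrite gnc g0c /c mul0n addr0 mulnCA PoszM addrC modzMDl //.
have := uE n; rewrite /u gen_n => /eqP.
rewrite -subr_eq0 opprD addNKr oppr_eq0 mulrn_eq0 (negPf lambda_neq0) orbF.
by rewrite eqn0Ngt n_gt0.
Qed.
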